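(* Let $n\ge3$. If $\mu$ is an even, zonal measure on $\mathbb{S}^{n-1}$ and $1\le i\le n-1$, then $$h(\Phi_i^\mu K,u)=2\int_{\mathrm{SO}(n)}h(\Pi_iK,\phi u)\,d\breve\mu_u(\phi),\quad u\in\mathbb{S}^{n-1},$$ for every $K\in\mathcal{K}^n$.
   Context: $\mathcal{K}^n$ is the set of compact convex subsets (convex bodies) of $\mathbb{R}^n$, $\mathbb{B}^n$ the Euclidean unit ball, $h(K,u)=\max\{u\cdot x:x\in K\}$ the support function. All measures are finite non-negative Borel measures and non-trivial. Fix a pole $\bar e\in\mathbb{S}^{n-1}$ with stabilizer $\mathrm{SO}(n-1)\subset\mathrm{SO}(n)$; a measure on $\mathbb{S}^{n-1}$ is zonal if it is $\mathrm{SO}(n-1)$-invariant, and even if invariant under $u\mapsto-u$. For an even zonal $\mu$ and $v\in\mathbb{S}^{n-1}$, let $\theta_v\in\mathrm{SO}(n)$ be any rotation with $\theta_v\bar e=v$; $Z^\mu(v)$ is the origin-symmetric convex body with $h(Z^\mu(v),u)=\int_{\mathbb{S}^{n-1}}|u\cdot\theta_v w|\,d\mu(w)$. Let $\pi:\mathrm{SO}(n)\to\mathbb{S}^{n-1}$, $\pi(\eta)=\eta\bar e$. $\breve\mu=\pi^*\mu$ is the pullback of $\mu$, i.e. the right $\mathrm{SO}(n-1)$-invariant measure on $\mathrm{SO}(n)$ with $\int f\,d\breve\mu=\int_{\mathbb{S}^{n-1}}\int_{\mathrm{SO}(n-1)}f(\theta_wk)\,dk\,d\mu(w)$ for $f\in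 C(\mathrm{SO}(n))$, with $dk$ the Haar probability measure. $\breve\mu_v$ is the pushforward of $\breve\mu$ under the conjugation $\phi\mapsto\theta_v\phi\theta_v^{-1}$ (independent of the choice of $\theta_v$). $S_i(K,\cdot)=S(K[i],\mathbb{B}^n[n-1-i],\cdot)$ is the $i$-th area measure, where the mixed area measure $S(K_1,\dots,K_{n-1},\cdot)$ is the unique finite Borel measure on $\mathbb{S}^{n-1}$ such that the mixed volume satisfies $V(K_1,\dots,K_{n-1},L)=\frac1n\int_{\mathbb{S}^{n-1}}h(L,u)\,dS(K_1,\dots,K_{n-1},u)$ for all $L\in\mathcal{K}^n$, and $K[i]$ means $i$ copies of $K$. The bodies $\Phi_i^\mu K$ and $\Pi_iK$ (projection body of order $i$) are defined by $$h(\Phi_i^\mu K,u)=\int_{\mathbb{S}^{n-1}}h(Z^\mu(v),u)\,dS_i(K,v),\qquad h(\Pi_iK,u)=\frac12\int_{\mathbb{S}^{n-1}}|u\cdot v|\,dS_i(K,v).$$ *)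

(* Defs.v *)
From HB Require Import structures.
From mathcomp Require Import all_boot all_order all_algebra all_fingroup.
From mathcomp Require Import all_classical all_reals all_analysis.

Set Implicit Arguments.
Unset Strict Implicit.
Unset Printing Implicit Defensive.

Import Order.TTheory GRing.Theory Num.Theory.
Import numFieldNormedType.Exports.

Local Open Scope classical_set_scope.
Local Open Scope ring_scope.

(* The ambient space R^d is 'cV[R]_d.  On the sphere and the rotation group
   the dimension has the form d = n.+1, because the measurable types of the
   library are pointed and the sphere of R^0 is empty. *)

Definition dot (R : realType) (d : nat) (x y : 'cV[R]_d) : R :=
  \sum_(j < d) x j 0 * y j 0.

Section SphereAndRotations.
Context (R : realType) (n : nat).

Definition sphere_set : set 'cV[R]_n.+1 := [set x | dot x x = 1].

Definition SO_set : set 'M[R]_n.+1 :=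
  [set A | A *m A^T = 1%:M /\ \det A = 1].

(* The topology is the one induced by the inclusion in the matrix space. *)
Definition sphere : Type := set_type sphere_set.
Definition SO : Type := set_type SO_set.

HB.instance Definition _ := Topological.copy sphere (set_type sphere_set).
HB.instance Definition _ := Topological.copy SO (set_type SO_set).

Definition vec (u : sphere) : 'cV[R]_n.+1 := set_val u.
Definition mat (phi : SO) : 'M[R]_n.+1 := set_val phi.

Definition mk_sphere (x : 'cV[R]_n.+1) (hx : sphere_set x) : sphere :=
  SigSub (mem_set hx).
Definition mk_SO (A : 'M[R]_n.+1) (hA : SO_set A) : SO := SigSub (mem_set hA).

Lemma dotE (x y : 'cV[R]_n.+1) : dot x y = (x^T *m y) 0 0.
Proof. by rewrite mxE; apply: eq_bigr => j _; rewrite mxE. Qed.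

Lemma vecP (u : sphere) : sphere_set (vec u).
Proof. by case: u => x hx; exact: set_mem hx. Qed.

Lemma matP (phi : SO) : SO_set (mat phi).
Proof. by case: phi => A hA; exact: set_mem hA. Qed.

Lemma SO_trmx (A : 'M[R]_n.+1) : SO_set A -> A^T *m A = 1%:M.
Proof. by case=> AAT _; exact: mulmx1C. Qed.

Lemma sphere_delta : sphere_set (delta_mx 0 0).
Proof. by rewrite /sphere_set /= dotE trmx_delta mul_delta_mx mxE !eqxx. Qed.

Lemma sphere_opp (x : 'cV[R]_n.+1) : sphere_set x -> sphere_set (- x).
Proof.
by rewrite /sphere_set /= => <-; apply: eq_bigr => j _; rewrite !mxE mulrNN.
Qed.

Lemma sphere_act (A : 'M[R]_n.+1) (x : 'cV[R]_n.+1) :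
  SO_set A -> sphere_set x -> sphere_set (A *m x).
Proof.
rewrite /sphere_set /= => /SO_trmx ATA.
by rewrite !dotE trmx_mul mulmxA -(mulmxA x^T) ATA mulmx1.
Qed.

Lemma SO_one : SO_set 1%:M.
Proof. by split; rewrite ?trmx1 ?mulmx1 ?det1. Qed.

Lemma SO_mul (A B : 'M[R]_n.+1) : SO_set A -> SO_set B -> SO_set (A *m B).
Proof.
move=> [AAT dA] [BBT dB]; split; last by rewrite det_mulmx dA dB mulr1.
by rewrite trmx_mul mulmxA -(mulmxA A) BBT mulmx1.
Qed.

Lemma SO_inv (A : 'M[R]_n.+1) : SO_set A -> SO_set A^T.
Proof.
by move=> hA; split; [rewrite trmxK; exact: SO_trmx | rewrite det_tr; case: hA].
Qed.

HB.instance Definition _ := isPointed.Build sphere (mk_sphere sphere_delta).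
HB.instance Definition _ := isPointed.Build SO (mk_SO SO_one).

Definition opps (u : sphere) : sphere := mk_sphere (sphere_opp (vecP u)).

Definition oneSO : SO := mk_SO SO_one.
Definition mulSO (phi psi : SO) : SO := mk_SO (SO_mul (matP phi) (matP psi)).
Definition invSO (phi : SO) : SO := mk_SO (SO_inv (matP phi)).
Definition conjSO (theta phi : SO) : SO := mulSO (mulSO theta phi) (invSO theta).

Definition act (phi : SO) (u : sphere) : sphere :=
  mk_sphere (sphere_act (matP phi) (vecP u)).

Definition stab_set (e : sphere) : set SO := [set k | act k e = e].

(* The copy of SO(d-1) in SO(d), d = n.+1, that fixes the pole [e]. *)
Definition stab (e : sphere) : Type := set_type (stab_set e).

HB.instance Definition _ (e : sphere) :=
  Topological.copy (stab e) (set_type (stab_set e)).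

Definition rot (e : sphere) (k : stab e) : SO := set_val k.

Lemma vec_inj : injective vec.
Proof. exact: val_inj. Qed.

Lemma stabP (e : sphere) (k : stab e) : stab_set e (rot k).
Proof. by case: k => k hk; exact: set_mem hk. Qed.

Lemma stab_one (e : sphere) : stab_set e oneSO.
Proof. by apply: vec_inj; exact: mul1mx. Qed.

Lemma stab_mul (e : sphere) (k l : SO) :
  stab_set e k -> stab_set e l -> stab_set e (mulSO k l).
Proof.
move=> hk hl; rewrite /stab_set /= -[in RHS]hk -[in RHS]hl.
by apply: vec_inj; rewrite /vec /=; exact: esym (mulmxA _ _ _).
Qed.

HB.instance Definition _ (e : sphere) :=
  isPointed.Build (stab e) (SigSub (mem_set (stab_one e))).

Definition mul_stab (e : sphere) (k l : stab e) : stab e :=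
  SigSub (mem_set (stab_mul (stabP k) (stabP l))).

End SphereAndRotations.

Arguments sphere : clear implicits.
Arguments SO : clear implicits.

Notation borel T := (g_sigma_algebraType (@open T)).

Section Measures.
Context (R : realType) (n : nat).
Local Open Scope ereal_scope.
Implicit Types (e : sphere R n)
  (mu : {finite_measure set (borel (sphere R n)) -> \bar R}).

Definition nontrivial_measure mu := mu setT != 0.

Definition even_measure mu :=
  forall A : set (borel (sphere R n)), measurable A ->
    mu [set u | A (opps u)] = mu A.

Definition zonal e mu :=
  forall (k : stab e) (A : set (borel (sphere R n))), measurable A ->
    mu [set u | A (act (rot k) u)] = mu A.

(* Left invariance suffices: a compact group is unimodular. *)
Definition is_haar e (dk : probability (borel (stab e)) R) :=
  forall (l : stab e) (A : set (borel (stab e))), measurable A ->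
    dk [set k | A (mul_stab l k)] = dk A.

(* [nu] is the pullback of [mu] under SO(d) -> S^{d-1}, phi |-> phi e;
   [theta v] is a rotation mapping [e] to [v]. *)
Definition is_pullback e (theta : sphere R n -> SO R n)
    (dk : probability (borel (stab e)) R) mu
    (nu : {finite_measure set (borel (SO R n)) -> \bar R}) :=
  (forall (k : stab e) (A : set (borel (SO R n))), measurable A ->
     nu [set phi | A (mulSO phi (rot k))] = nu A) /\
  (forall f : SO R n -> R, continuous f ->
     \int[nu]_phi (f phi)%:E =
     \int[mu]_w \int[dk]_k (f (mulSO (theta w) (rot k)))%:E).

Definition conj_measure (theta : SO R n)
    (nu : {finite_measure set (borel (SO R n)) -> \bar R}) :
    set (borel (SO R n)) -> \bar R :=
  pushforward nu (conjSO theta : borel (SO R n) -> borel (SO R n)).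

End Measures.

Section ConvexBodies.
Context (R : realType) (d : nat).
Implicit Types K L : set 'cV[R]_d.

Definition convex_body K :=
  [/\ K !=set0, compact K & convex_set (K : set (convex_lmodType 'cV[R]_d))].

Definition unit_ball : set 'cV[R]_d := [set x | dot x x <= 1].

Definition support_fun K (u : 'cV[R]_d) : R := sup [set dot u x | x in K].

Definition minkowski_comb (m : nat) (lam : 'I_m -> R)
    (K : 'I_m -> set 'cV[R]_d) : set 'cV[R]_d :=
  [set \sum_(j < m) lam j *: x j | x in [set x | forall j, K j (x j)]].

End ConvexBodies.

(* Lebesgue measure of R^d, as the d-fold product of the one-dimensional one,
   written as an iterated integral over sections. *)
Fixpoint lebesgue_cV (R : realType) (d : nat) : set 'cV[R]_d -> \bar R :=
  match d with
  | 0 => fun A => (\1_A 0)%:E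
  | d'.+1 => fun A : set 'cV[R]_(1 + d') =>
      (\int[@lebesgue_measure R]_x
        lebesgue_cV [set y | A (col_mx x%:M y)])%E
  end.

Definition volume (R : realType) (d : nat) (K : set 'cV[R]_d) : R :=
  fine (lebesgue_cV K).

(* The mixed volume: the symmetric functional whose values are the
   coefficients of the volume polynomial of Minkowski combinations. *)
Definition is_mixed_volume (R : realType) (d : nat)
    (V : ('I_d -> set 'cV[R]_d) -> R) :=
  (forall (K : 'I_d -> set 'cV[R]_d) (s : 'S_d),
     (forall j, convex_body (K j)) -> V (fun j => K (s j)) = V K) /\
  (forall (m : nat) (K : 'I_m -> set 'cV[R]_d) (lam : 'I_m -> R),
     (forall j, convex_body (K j)) -> (forall j, 0 <= lam j) ->
     volume (minkowski_comb lam K) =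
     \sum_(f : {ffun 'I_d -> 'I_m})
        (\prod_(j < d) lam (f j)) * V (fun j => K (f j))).

Definition mixed_volume (R : realType) (d : nat) :
    ('I_d -> set 'cV[R]_d) -> R :=
  xget (fun=> 0) [set V | is_mixed_volume V].

Section AreaMeasuresAndBodies.
Context (R : realType) (n : nat).
Local Open Scope ereal_scope.
Implicit Types (K L : set 'cV[R]_n.+1) (u v w : sphere R n).

(* The bodies and measures below are characterised by their defining property
   (a convex body by its support function, an area measure by its integrals of
   support functions) and selected by choice. *)

Definition append_body (K : 'I_n -> set 'cV[R]_n.+1) L :
    'I_n.+1 -> set 'cV[R]_n.+1 :=
  fun j => oapp K L (insub (val j)).

Definition is_mixed_area (K : 'I_n -> set 'cV[R]_n.+1)
    (S : {finite_measure set (borel (sphere R n)) -> \bar R}) :=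
  forall L, convex_body L ->
    (mixed_volume (append_body K L))%:E =
    (n.+1%:R^-1)%:E * \int[S]_u (support_fun L (vec u))%:E.

Definition mixed_area (K : 'I_n -> set 'cV[R]_n.+1) :
    {finite_measure set (borel (sphere R n)) -> \bar R} :=
  if pselect (exists S, is_mixed_area K S) is left ex then sval (cid ex)
  else mzero.

Definition area (i : nat) K :=
  mixed_area (fun j : 'I_n => if (j < i)%N then K else @unit_ball R n.+1).

Definition Zbody (theta : sphere R n -> SO R n)
    (mu : {finite_measure set (borel (sphere R n)) -> \bar R}) v :
    set 'cV[R]_n.+1 :=
  xget set0 [set Z | [/\ convex_body Z, (forall x, Z x -> Z (- x)%R) &
    forall u : 'cV[R]_n.+1,
      (support_fun Z u)%:E = \int[mu]_w `|dot u (vec (act (theta v) w))|%:E]].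

Definition Phi (theta : sphere R n -> SO R n)
    (mu : {finite_measure set (borel (sphere R n)) -> \bar R}) (i : nat) K :
    set 'cV[R]_n.+1 :=
  xget set0 [set P | convex_body P /\
    forall u : 'cV[R]_n.+1,
      (support_fun P u)%:E = \int[area i K]_v (support_fun (Zbody theta mu v) u)%:E].

Definition projection_body (i : nat) K : set 'cV[R]_n.+1 :=
  xget set0 [set P | convex_body P /\
    forall u : 'cV[R]_n.+1,
      (support_fun P u)%:E = (2^-1)%:E * \int[area i K]_v `|dot u (vec v)|%:E].

End AreaMeasuresAndBodies.

(* Main.v *)
(* The cosine transform of the zonal measure mu only sees the component of its
   argument along the pole e, because for d >= 3 the stabilizer of e acts
   transitively on the vectors of given norm and given product with e.  Since
   theta_v^-1 u and theta_u^-1 v have the same product u . v with e, the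
   function h (Z^mu v) u = int |theta_v^-1 u . w| dmu w is symmetric in u and v,
   and Tonelli gives
     h (Phi K) u = int int |v . theta_u w| dS_i(K, v) dmu w
                 = 2 int h (Pi_i K) (theta_u w) dmu w.
   The last integral is the one over the pullback, because
   theta_u theta_w k theta_u^-1 u = theta_u w for k in the stabilizer.
   Of the area measure only its finiteness matters.  The bodies exist because
   each defining integral is sublinear in the direction, and every sublinear
   function on R^d is a support function. *)
Require Import Defs.
From mathcomp Require Import all_boot all_order all_algebra.
From mathcomp Require Import all_classical all_reals all_analysis measurable_realfun.
From mathcomp Require Import ring lra.

Set Implicit Arguments.
Unset Strict Implicit.
Unset Printing Implicit Defensive.

Import Order.TTheory GRing.Theory Num.Theory.
Import numFieldNormedType.Exports.

Local Open Scope classical_set_scope.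
Local Open Scope ring_scope.

(** * Reflections and the stabilizer of the pole *)

Section Dot.
Variables (R : realType) (d : nat).
Implicit Types x y z : 'cV[R]_d.

Lemma dotC x y : dot x y = dot y x.
Proof. by apply: eq_bigr => j _; rewrite mulrC. Qed.

Lemma dotDl x y z : dot (x + y) z = dot x z + dot y z.
Proof. by rewrite -big_split; apply: eq_bigr => j _; rewrite mxE mulrDl. Qed.

Lemma dotZl (t : R) x y : dot (t *: x) y = t * dot x y.
Proof. by rewrite mulr_sumr; apply: eq_bigr => j _; rewrite mxE mulrA. Qed.

Lemma dotDr x y z : dot x (y + z) = dot x y + dot x z.
Proof. by rewrite dotC dotDl !(dotC _ x). Qed.

Lemma dotZr (t : R) x y : dot x (t *: y) = t * dot x y.
Proof. by rewrite dotC dotZl dotC. Qed.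

Lemma dotNl x y : dot (- x) y = - dot x y.
Proof. by rewrite -scaleN1r dotZl mulN1r. Qed.

Lemma dotNr x y : dot x (- y) = - dot x y.
Proof. by rewrite dotC dotNl dotC. Qed.

Lemma dot_mx x y : (x^T *m y) = (dot x y)%:M.
Proof.
rewrite [LHS]mx11_scalar mxE; congr _%:M.
by apply: eq_bigr => j _; rewrite mxE.
Qed.

Lemma dot_mulmxl (A : 'M[R]_d) x y : dot (A *m x) y = dot x (A^T *m y).
Proof.
have := dot_mx (A *m x) y; rewrite trmx_mul -mulmxA dot_mx.
by move/matrixP/(_ 0 0); rewrite !mxE eqxx !mulr1n.
Qed.

Lemma dot_eq0 x : (dot x x == 0) = (x == 0).
Proof.
apply/eqP/eqP => [/eqP|->]; last by rewrite /dot big1// => j _; rewrite mxE mul0r.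
rewrite psumr_eq0 => [/allP x0|j _]; last by rewrite -expr2 sqr_ge0.
apply/colP => j; rewrite mxE; apply/eqP.
by have := x0 j (mem_index_enum j); rewrite mulf_eq0 orbb.
Qed.

End Dot.

(* Both sides are the determinant of the block matrix [1, v; u, 1]. *)
Lemma det_rank1_update (R : comPzRingType) (m : nat)
  (u : 'cV[R]_m) (v : 'rV[R]_m) :
  \det (1%:M - u *m v) = 1 - (v *m u) 0 0.
Proof.
have E1 : block_mx 1%:M v u 1%:M =
    block_mx 1%:M 0 u 1%:M *m block_mx 1%:M v 0 (1%:M - u *m v) :> 'M[R]_(1 + m).
  by rewrite mulmx_block !mul1mx !mulmx1 !mulmx0 ?mul0mx ?addr0 addrC subrK.
have E2 : block_mx 1%:M v u 1%:M =
    block_mx (1%:M - v *m u) v 0 1%:M *m block_mx 1%:M 0 u 1%:M :> 'M[R]_(1 + m).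
  by rewrite mulmx_block !mul1mx !mulmx1 !mulmx0 ?mul0mx ?add0r subrK.
have := congr1 determinant E2; rewrite E1 !det_mulmx !det_lblock !det_ublock !det1.
by rewrite !mul1r !mulr1 [in RHS]det_mx11 !mxE.
Qed.

Section Reflection.
Variables (R : realType) (n : nat).
Implicit Types a x y z : 'cV[R]_n.+1.

(** The Householder reflection in the hyperplane orthogonal to [a], which need not be a unit vector;
    [a = 0] gives the identity. *)
Definition reflection a : 'M[R]_n.+1 :=
  1%:M - ((2 / dot a a) *: a) *m a^T.

Lemma reflectionE a x : reflection a *m x = x - (2 * dot a x / dot a a) *: a.
Proof.
rewrite mulmxBl mul1mx -mulmxA dot_mx mul_mx_scalar scalerA.
by congr (_ - _ *: _); ring.
Qed.

Lemma tr_reflection a : (reflection a)^T = reflection a.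
Proof.
rewrite /reflection linearB/= trmx1 trmx_mul trmxK linearZ/=.
by rewrite -scalemxAr -scalemxAl.
Qed.

Lemma reflectionK a : a != 0 -> reflection a *m reflection a = 1%:M.
Proof.
move=> a0; have aa : dot a a != 0 by rewrite dot_eq0.
have ra (c : R) : reflection a *m (c *: a) = - (c *: a).
  rewrite reflectionE dotZr -scalerBl -[RHS]scaleNr; congr (_ *: a).
  by field.
by rewrite {2}/reflection mulmxBr mulmx1 mulmxA ra mulNmx opprK subrK.
Qed.

Lemma det_reflection a : a != 0 -> \det (reflection a) = -1.
Proof.
move=> a0; have aa : dot a a != 0 by rewrite dot_eq0.
rewrite det_rank1_update dot_mx !mxE eqxx mulr1n dotZr.
by field.
Qed.

Lemma reflection_id a x : dot a x = 0 -> reflection a *m x = x.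
Proof. by move=> ax; rewrite reflectionE ax mulr0 mul0r scale0r subr0. Qed.

(** Equal norms give 2 (x - y) . x = |x - y|^2, so the reflection subtracts exactly x - y from x. *)
Lemma reflection_swap x y : dot x x = dot y y -> x != y ->
  reflection (x - y) *m x = y.
Proof.
move=> xy neq; have aa : dot (x - y) (x - y) != 0 by rewrite dot_eq0 subr_eq0.
have c1 : 2 * dot (x - y) x / dot (x - y) (x - y) = 1.
  apply: (mulIf aa); rewrite mulfVK// mul1r.
  by rewrite !(dotDl, dotDr, dotNl, dotNr) (dotC y x) -xy; ring.
by rewrite reflectionE c1 scale1r opprB addrC subrK.
Qed.

Lemma exists_orthogonal2 x y : (2 <= n)%N ->
  exists z, [/\ z != 0, dot z x = 0 & dot z y = 0].
Proof.
move=> n2; pose A : 'M[R]_(n.+1, 1 + 1) := row_mx x y.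
(* Two columns have rank at most 2 < [n.+1], so the left kernel of [A] is nonzero. *)
have /rowV0Pn[v /sub_kermxP vA v0] : kermx A != 0.
  rewrite -mxrank_eq0 mxrank_ker -lt0n subn_gt0 ltnS.
  exact: leq_trans (rank_leq_col A) n2.
exists v^T; rewrite trmx_eq0; split=> //.
- have /(congr1 lsubmx) := vA; rewrite mul_mx_row row_mxKl linear0.
  rewrite -{1}(trmxK v) dot_mx => /matrixP/(_ 0 0).
  by rewrite !mxE eqxx mulr1n.
- have /(congr1 rsubmx) := vA; rewrite mul_mx_row row_mxKr linear0.
  rewrite -{1}(trmxK v) dot_mx => /matrixP/(_ 0 0).
  by rewrite !mxE eqxx mulr1n.
Qed.

(** The reflection along x - y carries x to y and fixes the pole, but has determinant -1. In
    dimension at least 3 some nonzero z is orthogonal to both the pole and y; the reflection along z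
    corrects the determinant and moves neither. *)
Lemma stab_transitive (e : sphere R n) x y : (2 <= n)%N ->
    dot x x = dot y y -> dot x (vec e) = dot y (vec e) ->
  exists k : stab e, mat (Defs.rot k) *m x = y.
Proof.
move=> n2 xx xe.
suff [A [SOA Ae Ax]] : exists A, [/\ SO_set A, A *m vec e = vec e & A *m x = y].
  have hA : stab_set e (mk_SO SOA) by exact: vec_inj.
  by exists (SigSub (mem_set hA)).
have [->|neq] := eqVneq x y.
  by exists 1%:M; rewrite !mul1mx; split=> //; exact: SO_one.
have [z [z0 ze zy]] := exists_orthogonal2 (vec e) y n2.
have a0 : x - y != 0 by rewrite subr_eq0.
exists (reflection z *m reflection (x - y)); split.
- split; last by rewrite det_mulmx !det_reflection// mulrNN mulr1.
  rewrite trmx_mul !tr_reflection mulmxA -(mulmxA (reflection z)).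
  by rewrite reflectionK// mulmx1 reflectionK.
- rewrite -mulmxA (reflection_id (a := x - y)) ?reflection_id//.
  by rewrite dotDl dotNl xe subrr.
- by rewrite -mulmxA reflection_swap// reflection_id.
Qed.

End Reflection.

(** * Sublinear functions and support functions *)

Section Sublinear.
Variables (R : realType) (V : lmodType R).
Implicit Types (p q : V -> R) (x y v a b : V).

Definition sublinear p :=
  (forall x y, p (x + y) <= p x + p y) /\
  (forall t x, 0 <= t -> p (t *: x) = t * p x).

Lemma sublinear0 p : sublinear p -> p 0 = 0.
Proof. by case=> _ /(_ 0 0 (lexx _)); rewrite scale0r mul0r. Qed.

Lemma sublinear_opp p x : sublinear p -> - p (- x) <= p x.
Proof.
move=> sp; have := sp.1 x (- x); rewrite subrr sublinear0//; lra.
Qed.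

(** Because q b >= - q (- b) >= - p (- b) = p b >= q b. Hence a direction once made odd stays so
    under later minorants. *)
Lemma sublinear_odd_below p q b : sublinear q -> (forall x, q x <= p x) ->
  p (- b) = - p b -> q b = p b /\ q (- b) = - q b.
Proof.
move=> sq qp pb; have := sublinear_opp b sq; have := qp b; have := qp (- b).
by rewrite pb; split; lra.
Qed.

(* Iterating over a spanning family turns p into a linear minorant: this is the
   finite-dimensional Hahn-Banach theorem. *)
Lemma sublinear_flatten p a : sublinear p ->
  exists q, [/\ sublinear q, forall x, q x <= p x & q (- a) = - p a].
Proof.
move=> sp; have p0 := sublinear0 sp; have [pD pZ] := sp.
(* The infimum [q] of these values is designed as the largest sublinear minorant of p whose value at
   - a is at most - p a. *)
pose A v := [set p (v + t *: a) - t * p a | t in [set t | 0 <= t]].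
pose q v := inf (A v).
have lbA v : lbound (A v) (- p (- v)).
  (* Here t p a = p (t a) <= p (v + t a) + p (- v). *)
  move=> _ [t /= t0 <-]; have := pD (v + t *: a) (- v).
  by rewrite addrC addKr pZ//; lra.
have A0 v : A v !=set0 by exists (p (v + 0 *: a) - 0 * p a), 0 => /=.
have hA v : has_lbound (A v) by exists (- p (- v)).
have qle v t : 0 <= t -> q v <= p (v + t *: a) - t * p a.
  by move=> t0; apply: ge_inf => //; exists t.
have qp v : q v <= p v.
  by have := qle v 0 (lexx _); rewrite scale0r addr0 mul0r subr0.
have qD x y : q (x + y) <= q x + q y.
  rewrite -lerBlDl; apply: lb_le_inf => // _ [s /= s0 <-].
  rewrite lerBlDr -lerBlDl; apply: lb_le_inf => // _ [t /= t0 <-].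
  have := qle (x + y) (t + s) (addr_ge0 t0 s0).
  have := pD (x + t *: a) (y + s *: a).
  by rewrite addrACA scalerDl mulrDl; lra.
(* One inequality suffices: used with 1 / t at the vector t x, it yields the reverse one. *)
have qZ t v : 0 < t -> t * q v <= q (t *: v).
  move=> t0; apply: lb_le_inf => // _ [s /= s0 <-].
  have ts : t * (s / t) = s by rewrite mulrC divfK ?gt_eqF.
  have := qle v (s / t) (divr_ge0 s0 (ltW t0)).
  rewrite -(ler_pM2l t0) mulrBr -(pZ t (v + _) (ltW t0)) scalerDr scalerA.
  by rewrite (mulrA t (s / t)) !ts.
have q0 : q 0 = 0.
  apply/eqP; rewrite eq_le -{1}p0 qp/=.
  by apply: lb_le_inf => // _ [s /= s0 <-]; rewrite add0r pZ// subrr.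
exists q; split=> //.
  split=> // t x; rewrite le_eqVlt => /predU1P[<-|t0]; first by rewrite scale0r mul0r.
  apply/eqP; rewrite eq_le qZ// andbT.
  have tV : 0 < t^-1 by rewrite invr_gt0.
  have := qZ t^-1 (t *: x) tV; rewrite scalerA mulVf ?gt_eqF// scale1r.
  by rewrite mulrC ler_pdivrMr// mulrC.
(* The choice t = 1 gives q (- a) <= - p a; the converse comes from 0 = q 0 <= q a + q (- a) and q a
   <= p a. *)
have := qle (- a) 1 ler01; rewrite scale1r addNr p0 mul1r.
by have := qD a (- a); rewrite subrr q0; have := qp a; lra.
Qed.

Lemma sublinear_flatten_seq p (s : seq V) : sublinear p ->
  exists q, [/\ sublinear q, forall x, q x <= p x &
    forall a, a \in s -> q (- a) = - q a].
Proof.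
move=> sp; elim: s => [|a s [q [sq qp qs]]]; first by exists p.
have [r [sr rq ra]] := sublinear_flatten a sq.
exists r; split=> // [x|b]; first exact: le_trans (rq x) (qp x).
rewrite inE => /predU1P[->|bs]; last first.
  by have [] := sublinear_odd_below sr rq (qs b bs).
have := rq a; have := sublinear_opp a sr; rewrite ra; lra.
Qed.

End Sublinear.

(** * Convex bodies with a prescribed sublinear support function *)

Section SupportBody.
Variables (R : realType) (d : nat).
Implicit Types (p : 'cV[R]_d -> R) (u v x : 'cV[R]_d).

Lemma sublinear_sum p (I : Type) (s : seq I) (F : I -> 'cV[R]_d) :
  sublinear p -> p (\sum_(i <- s) F i) <= \sum_(i <- s) p (F i).
Proof.
move=> sp; elim: s => [|i s ih]; first by rewrite !big_nil sublinear0.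
by rewrite !big_cons (le_trans (sp.1 _ _))// lerD2l.
Qed.

Lemma col_sum_delta v : v = \sum_j v j 0 *: delta_mx j 0.
Proof.
rewrite {1}(matrix_sum_delta v); apply: eq_bigr => j _.
by rewrite big_ord1 (ord1 ord0).
Qed.

(** Flattening along u first forces q (- u) = - p u. Flattening next along u and the coordinate
    vectors gives a linear minorant r, the product with some x; being odd at u and below q, it still
    attains p u there. *)
Lemma sublinear_touching p u : sublinear p ->
  exists x, (forall v, dot v x <= p v) /\ dot u x = p u.
Proof.
move=> sp; have [q [sq qp qu]] := sublinear_flatten u sp.
have [r [sr rq rs]] := sublinear_flatten_seq
  (u :: [seq delta_mx j 0 | j <- enum 'I_d]) sq.
have rdelta j : r (- delta_mx j 0) = - r (delta_mx j 0).
  apply: rs; rewrite inE; apply/orP; right.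
  by apply: (map_f (fun j => delta_mx j 0)); rewrite mem_enum.
pose x : 'cV_d := \col_j r (delta_mx j 0).
have rle v : r v <= dot v x.
  rewrite {1}(col_sum_delta v) (le_trans (sublinear_sum _ _ sr))//.
  apply: ler_sum => j _; rewrite mxE; have [v0|v0] := leP 0 (v j 0).
    by rewrite sr.2.
  have v0' : 0 <= - v j 0 by rewrite oppr_ge0 ltW.
  by rewrite -{1}(opprK (v j 0)) scaleNr -scalerN (sr.2 _ _ v0') rdelta mulrNN.
(* The bound [rle] at - v, combined with - r (- v) <= r v, gives the converse inequality. *)
have rE v : r v = dot v x.
  apply/eqP; rewrite eq_le rle/=; have := rle (- v); rewrite dotNl.
  by have := sublinear_opp v sr; lra.
exists x; split=> [v|]; first by rewrite -rE (le_trans (rq _)).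
rewrite -rE; have ru : r (- u) = - r u by apply: rs; rewrite mem_head.
have := rq (- u); rewrite qu ru; have := rq u; have := qp u; lra.
Qed.

(** The Wulff shape of p: an intersection of closed half-spaces. *)
Definition support_body p : set 'cV[R]_d := [set x | forall v, dot v x <= p v].

Lemma support_fun_body p u : sublinear p -> support_fun (support_body p) u = p u.
Proof.
move=> sp; have [x [px ux]] := sublinear_touching u sp.
have ub : ubound [set dot u x | x in support_body p] (p u).
  by move=> _ [y py <-]; exact: py.
apply/eqP; rewrite eq_le; apply/andP; split.
  by apply: ge_sup => //; exists (dot u x), x.
by rewrite -ux; apply: ub_le_sup; [exists (p u)|exists x].
Qed.

Lemma mx_continuous (T : topologicalType) (m k : nat) (f : T -> 'M[R]_(m, k)) :
  (forall i j, continuous (fun t => f t i j)) -> continuous f.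
Proof.
move=> cf t A [P MP sPA]; apply: (@filterS _ _ _ [set s | forall i j, P i j (f s i j)]).
  by move=> s Ps; apply: sPA.
by apply: filter_forall => i; apply: filter_forall => j; apply: cf.
Qed.

Lemma continuous_sumr (T : topologicalType) (I : Type) (s : seq I)
  (F : I -> T -> R) :
  (forall i, continuous (F i)) -> continuous (fun t => \sum_(i <- s) F i t).
Proof. by move=> cF; apply: continuous_big => //; exact: add_continuous. Qed.

Lemma dot_continuous u : continuous (dot u).
Proof.
apply: continuous_sumr => j x; apply: continuousM; first exact: cst_continuous.
exact: coord_continuous.
Qed.

Lemma support_body_closed p : closed (support_body p).
Proof.
rewrite (_ : support_body p = \bigcap_v (dot v @^-1` [set r | r <= p v])).
  apply: closed_bigI => v _; move/continuous_closedP: (@dot_continuous v); apply.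
  exact: closed_le.
by apply/seteqP; split=> x px v => [_|]; apply: px.
Qed.

Lemma support_body_compact p : compact (support_body p).
Proof.
have trc (m k : nat) : continuous (@trmx R m k).
  apply: mx_continuous => i j x; rewrite /continuous_at mxE.
  by under eq_fun do rewrite mxE; exact: coord_continuous.
(* [bounded_closed_compact] concerns row vectors, so the body is written as a continuous image of
   its transpose. *)
rewrite (_ : support_body p = trmx @` [set y : 'rV_d | support_body p y^T]).
  apply: continuous_compact; first exact/continuous_subspaceT/trc.
  apply: bounded_closed_compact; last first.
    by move/continuous_closedP: (trc 1%N d); apply; exact: support_body_closed.
  (* The half-spaces of the coordinate vectors e_j and - e_j confine the j-th entry to
     [- p (- e_j), p e_j], so [M] bounds every entry. *)
  pose M := \sum_j (`|p (delta_mx j 0)| + `|p (- delta_mx j 0)|).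
  exists M; split; first exact: num_real.
  move=> B MB y /= py; rewrite [leLHS]/Num.norm/= mx_normrE.
  have M0 j : 0 <= `|p (delta_mx j 0)| + `|p (- delta_mx j 0)| by rewrite addr_ge0.
  apply: bigmax_le => [|[i j] _ /=].
    by rewrite (le_trans _ (ltW MB))// sumr_ge0.
  rewrite (le_trans _ (ltW MB))// /M (bigD1 j)//= ler_wpDr ?sumr_ge0//.
  have yj : y i j = dot (delta_mx j 0) y^T.
    rewrite /dot (bigD1 j)//= !mxE !eqxx mul1r (ord1 i) big1 ?addr0// => l lj.
    by rewrite !mxE (negbTE lj) mul0r.
  have := py (delta_mx j 0); have := py (- delta_mx j 0).
  rewrite dotNl -yj ler_norml => h1 h2.
  have := ler_norm (p (delta_mx j 0)); have := ler_norm (p (- delta_mx j 0)).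
  have := normr_ge0 (p (delta_mx j 0)); have := normr_ge0 (p (- delta_mx j 0)).
  by move=> *; apply/andP; split; lra.
apply/seteqP; split=> [x px|_ [y py <-]//].
by exists x^T; rewrite /= trmxK.
Qed.

Lemma support_body_convex p :
  convex_set (support_body p : set (convex_lmodType 'cV[R]_d)).
Proof.
move=> x y l /set_mem px /set_mem py; apply/mem_set => v.
rewrite /conv/= dotDr !dotZr.
have l0 : 0 <= l%:num by [].
have l1 : 0 <= 1 - l%:num by rewrite subr_ge0.
apply: le_trans (lerD (ler_wpM2l l0 (px v)) (ler_wpM2l l1 (py v))) _.
by rewrite -mulrDl addrC subrK mul1r.
Qed.

Lemma support_bodyP p : sublinear p -> convex_body (support_body p).
Proof.
move=> sp; split; [|exact: support_body_compact|exact: support_body_convex].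
by have [x [px _]] := sublinear_touching 0 sp; exists x.
Qed.

End SupportBody.

(** * Measurability and integrals of sublinear functions *)

Section BorelMeasurability.
Variable R : realType.

Lemma continuous_measurable_borel (T U : ptopologicalType) (f : T -> U) :
  continuous f -> measurable_fun setT (f : borel T -> borel U).
Proof.
move=> /continuousP cf.
apply: (@measurability _ _ (borel T) (borel U) setT f (@open U) erefl).
move=> _ [B oB <-].
by rewrite setTI; apply: sub_sigma_algebra; exact: cf.
Qed.

Lemma continuous_measurable_realfun (T : ptopologicalType) (f : T -> R) :
  continuous f -> measurable_fun setT (f : borel T -> R).
Proof.
move=> /continuousP cf; apply: (measurability _ (RGenOpens.measurableE R)).
move=> _ [_ [a [b ->]] <-]; rewrite setTI.
by apply: sub_sigma_algebra; apply: cf; exact: interval_open.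
Qed.

Lemma mulmx_continuousl (m k l : nat) (A : 'M[R]_(m, k)) :
  continuous (mulmx A : 'M[R]_(k, l) -> _).
Proof.
apply: mx_continuous => i j; under eq_fun do rewrite mxE.
apply: continuous_sumr => r M; apply: continuousM; first exact: cst_continuous.
exact: coord_continuous.
Qed.

Lemma mulmx_continuousr (m k l : nat) (A : 'M[R]_(k, l)) :
  continuous ((fun M => M *m A) : 'M[R]_(m, k) -> _).
Proof.
apply: mx_continuous => i j; under eq_fun do rewrite mxE.
apply: continuous_sumr => r M; apply: continuousM; last exact: cst_continuous.
exact: coord_continuous.
Qed.

Variable n : nat.

Lemma vec_continuous : continuous (@vec R n).
Proof. exact: initial_continuous. Qed.

Lemma mat_continuous : continuous (@mat R n).
Proof. exact: initial_continuous. Qed.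

Lemma act_continuous (phi : SO R n) : continuous (act phi).
Proof.
apply: continuous_comp_initial => u.
apply: (@continuous_comp _ _ _ (@vec R n) (mulmx (mat phi))).
  exact: vec_continuous.
exact: mulmx_continuousl.
Qed.

Lemma act_continuousl (u : sphere R n) : continuous (fun phi => act phi u).
Proof.
apply: continuous_comp_initial => phi.
apply: (@continuous_comp _ _ _ (@mat R n) (mulmx ^~ (vec u))).
  exact: mat_continuous.
exact: mulmx_continuousr.
Qed.

Lemma conjSO_continuous (theta : SO R n) : continuous (conjSO theta).
Proof.
apply: continuous_comp_initial => phi.
apply: (@continuous_comp _ _ _ (fun phi => mat theta *m mat phi)
  (mulmx ^~ (mat theta)^T)).
  apply: (@continuous_comp _ _ _ (@mat R n) (mulmx (mat theta))).
    exact: mat_continuous.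
  exact: mulmx_continuousl.
exact: mulmx_continuousr.
Qed.

End BorelMeasurability.

Section SublinearContinuity.
Variables (R : realType) (d : nat) (p : 'cV[R]_d -> R).
Hypothesis sp : sublinear p.

Lemma sublinear_bound v :
  p v <= \sum_j `|v j 0| * (`|p (delta_mx j 0)| + `|p (- delta_mx j 0)|).
Proof.
rewrite {1}(col_sum_delta v) (le_trans (sublinear_sum _ _ sp))//.
apply: ler_sum => j _; have [v0|v0] := leP 0 (v j 0).
  rewrite sp.2// ger0_norm// ler_wpM2l// (le_trans (ler_norm _))//.
  by rewrite lerDl.
have v0' : 0 <= - v j 0 by rewrite oppr_ge0 ltW.
rewrite -{1}(opprK (v j 0)) scaleNr -scalerN (sp.2 _ _ v0') ltr0_norm//.
by rewrite ler_wpM2l// (le_trans (ler_norm _))// lerDr.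
Qed.

(** Both p y - p x <= p (y - x) and p x - p y <= p (x - y) are at most [B y], by [sublinear_bound];
    [B] is continuous and vanishes at x. *)
Lemma sublinear_continuous : continuous p.
Proof.
move=> x; pose c j : R := `|p (delta_mx j 0)| + `|p (- delta_mx j 0)|.
pose B (y : 'cV[R]_d) : R := \sum_j `|y j 0 - x j 0| * c j.
have ctB : continuous B.
  apply: continuous_sumr => j y.
  apply: (@continuousM _ _ (fun y : 'cV[R]_d => `|y j 0 - x j 0|) (fun=> c j));
    last exact: cst_continuous.
  apply: (@continuous_comp _ _ _ (fun y : 'cV[R]_d => y j 0 - x j 0) Num.norm);
    last exact: norm_continuous.
  apply: continuousB; last exact: cst_continuous.
  exact: coord_continuous.
have Bx : B x = 0 by rewrite /B big1// => j _; rewrite subrr normr0 mul0r.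
have low : {for x, continuous (fun y => p x - B y)}.
  by apply: continuousB; [exact: cst_continuous|exact: ctB].
have upp : {for x, continuous (fun y => p x + B y)}.
  by apply: continuousD; [exact: cst_continuous|exact: ctB].
rewrite /prop_for /continuous_at Bx subr0 in low.
rewrite /prop_for /continuous_at Bx addr0 in upp.
apply: squeeze_cvgr low upp; apply: nearW => y.
have := sublinear_bound (y - x); have := sublinear_bound (x - y).
have := sp.1 (y - x) x; have := sp.1 (x - y) y; rewrite !subrK.
have -> : \sum_j `|(y - x) j 0| * c j = B y.
  by apply: eq_bigr => j _; rewrite !mxE.
have -> : \sum_j `|(x - y) j 0| * c j = B y.
  by apply: eq_bigr => j _; rewrite !mxE distrC.
by move=> *; apply/andP; split; lra.
Qed.

End SublinearContinuity.

Section IntegralOfSublinear.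
Variables (R : realType) (d : nat) (disp : measure_display).
Variables (T : measurableType disp) (m : {finite_measure set T -> \bar R}).
Local Open Scope ereal_scope.

(** The bound [c u] does not depend on t, so the integrals over the finite measure are finite and
    [fine] loses nothing; sublinearity then follows from monotonicity and linearity of the
    integral. *)
Lemma sublinear_integral (h : T -> 'cV[R]_d -> R) (c : 'cV[R]_d -> R) :
    (forall t, sublinear (h t)) -> (forall t u, 0 <= h t u <= c u)%R ->
    (forall u, measurable_fun setT (h ^~ u)) ->
  exists p, sublinear p /\ forall u, (p u)%:E = \int[m]_t (h t u)%:E.
Proof.
move=> sh hc mh; exists (fun u => fine (\int[m]_t (h t u)%:E)).
have h0 t u : (0 <= h t u)%R by have /andP[] := hc t u.
have mEh u : measurable_fun setT (EFin \o h ^~ u) by exact/measurable_EFinP.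
have fin u : \int[m]_t (h t u)%:E \is a fin_num.
  rewrite ge0_fin_numE ?integral_ge0//; last by move=> t _; rewrite lee_fin.
  apply: (@le_lt_trans _ _ (\int[m]_t (cst (c u)%:E t))).
    apply: ge0_le_integral => // [t _||t _]; [by rewrite lee_fin|exact: mEh|].
    by rewrite lee_fin; have /andP[] := hc t u.
  rewrite integral_cst//; apply: lte_mul_pinfty => //.
    (* Evaluating the bounds at one point of the space shows that [c u] is nonnegative. *)
    by rewrite lee_fin; have /andP[/le_trans h1 /h1] := hc point u.
  by rewrite ltey_eq fin_num_measure.
split=> [|u]; last by rewrite fineK.
split=> [x y|t x t0].
  rewrite -lee_fin EFinD !fineK// -ge0_integralD//; do ?exact: mEh.
  - apply: ge0_le_integral => //.
    + by move=> t _; rewrite lee_fin.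
    + exact: mEh.
    + by apply: emeasurable_funD; exact: mEh.
    + by move=> t _; rewrite -EFinD lee_fin; exact: (sh t).1.
  - by move=> t _; rewrite lee_fin.
  - by move=> t _; rewrite lee_fin.
apply: EFin_inj; rewrite EFinM !fineK// -ge0_integralZl_EFin//.
  by apply: eq_integral => s _; rewrite (sh s).2.
  by move=> s _; rewrite lee_fin.
exact: mEh.
Qed.

End IntegralOfSublinear.

(** * The bodies Z, Pi and Phi *)

Section AbsDot.
Variables (R : realType) (n : nat).
Implicit Types (u v w : sphere R n) (x y : 'cV[R]_n.+1).

Lemma dot_act (phi : SO R n) x w :
  dot x (vec (act phi w)) = dot ((mat phi)^T *m x) (vec w).
Proof. by rewrite dot_mulmxl trmxK. Qed.

Lemma abs_dot_le x w : `|dot x (vec w)| <= \sum_j `|x j 0|.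
Proof.
apply: le_trans (ler_norm_sum _ _ _) _; apply: ler_sum => j _.
rewrite normrM ler_piMr// -(@ler_pXn2r _ 2) ?nnegrE// expr1n.
rewrite -normrX ger0_norm ?sqr_ge0//; have := vecP w; rewrite /sphere_set /= => <-.
rewrite /dot (bigD1 j)//= -expr2 lerDl sumr_ge0// => i _.
by rewrite -expr2 sqr_ge0.
Qed.

Lemma sublinear_abs_dot y : sublinear (fun x => `|dot x y|).
Proof.
split=> [x z|t x t0]; first by rewrite dotDl ler_normD.
by rewrite dotZl normrM ger0_norm.
Qed.

Lemma measurable_abs_dot x :
  measurable_fun setT ((fun w => `|dot x (vec w)|) : borel (sphere R n) -> R).
Proof.
apply: continuous_measurable_realfun => w.
apply: (@continuous_comp _ _ _ (fun w => dot x (vec w)) Num.norm);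
  last exact: norm_continuous.
apply: (@continuous_comp _ _ _ (@vec R n) (dot x)); first exact: vec_continuous.
exact: dot_continuous.
Qed.

(** Tonelli refers to the product of the two Borel sigma-algebras, so the function is assembled from
    measurable coordinates. *)
Lemma measurable_abs_dot_act (phi : SO R n) :
  measurable_fun setT ((fun vw => `|dot (vec vw.1) (vec (act phi vw.2))|) :
    (borel (sphere R n) * borel (sphere R n))%type -> R).
Proof.
apply: measurableT_comp; first exact: normr_measurable.
have coord j :
    measurable_fun setT ((fun w => vec w j 0) : borel (sphere R n) -> R).
  apply: continuous_measurable_realfun => w.
  apply: (@continuous_comp _ _ _ (@vec R n) (fun x => x j 0)).
    exact: vec_continuous.
  exact: coord_continuous.
have mact : measurable_fun setT
    (act phi : borel (sphere R n) -> borel (sphere R n)).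
  by apply: continuous_measurable_borel; exact: act_continuous.
apply: measurable_sum => j; apply: measurable_funM.
  exact: (measurableT_comp (coord j) measurable_fst).
exact: (measurableT_comp (coord j) (measurableT_comp mact measurable_snd)).
Qed.

End AbsDot.

Lemma act_mulSO (R : realType) (n : nat) (phi psi : SO R n) (u : sphere R n) :
  act (mulSO phi psi) u = act phi (act psi u).
Proof. by apply: vec_inj; exact: esym (mulmxA _ _ _). Qed.

Section Bodies.
Variables (R : realType) (n : nat).
Local Open Scope ereal_scope.
Implicit Types (K : set 'cV[R]_n.+1)
  (m : {finite_measure set (borel (sphere R n)) -> \bar R}).
Variable theta : sphere R n -> SO R n.

(** The cosine transform of [m] precomposed with [A]: a transposed rotation for [Zbody], the
    identity for projection bodies. *)
Lemma cosine_sublinear m (A : 'M[R]_n.+1) :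
  exists p, sublinear p /\
    forall x, (p x)%:E = \int[m]_w `|dot (A *m x) (vec w)|%:E.
Proof.
apply: (@sublinear_integral R n.+1 _ _ m (fun w x => `|dot (A *m x) (vec w)|%R)
  (fun x => \sum_j `|(A *m x) j 0|)%R).
- move=> w; have [sD sZ] := sublinear_abs_dot (vec w).
  by split=> [x y|t x t0]; rewrite ?mulmxDr -?scalemxAr; [exact: sD|exact: sZ].
- by move=> w x; rewrite normr_ge0 abs_dot_le.
- by move=> x; exact: measurable_abs_dot.
Qed.

(** The choice made by [xget] has its defining property as soon as one candidate exists, here the
    support body of a cosine transform. *)
Lemma support_fun_Zbody mu v x :
  (support_fun (Zbody theta mu v) x)%:E =
  \int[mu]_w `|dot ((mat (theta v))^T *m x) (vec w)|%:E.
Proof.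
have [p [sp pE]] := cosine_sublinear mu (mat (theta v))^T.
have ex : exists Z, [/\ convex_body Z, (forall x, Z x -> Z (- x)%R) &
    forall u : 'cV[R]_n.+1,
      (support_fun Z u)%:E = \int[mu]_w `|dot u (vec (act (theta v) w))|%:E].
  exists (support_body p); split=> [|y py z|u].
  - exact: support_bodyP.
  (* The cosine transform is even, whence the candidate is origin-symmetric. *)
  - have -> : p z = p (- z)%R; last by rewrite dotNr -dotNl; exact: py.
    apply: EFin_inj; rewrite !pE; apply: eq_integral => w _.
    by rewrite mulmxN dotNl normrN.
  - rewrite support_fun_body// pE; apply: eq_integral => w _.
    by rewrite dot_act.
have [_ _ ->] := xgetPex set0 ex.
by apply: eq_integral => w _; rewrite dot_act.
Qed.

(** Half the cosine transform of the area measure is sublinear, so a body exists. Returning [p]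
    makes continuity of the support function available later. *)
Lemma projection_body_sublinear i K :
  exists p, sublinear p /\ forall x, p x = support_fun (projection_body i K) x
    /\ (p x)%:E = 2^-1%:E * \int[area i K]_v `|dot x (vec v)|%:E.
Proof.
have [p [sp pE]] := cosine_sublinear (area i K) 1%:M.
pose q x := (2^-1 * p x)%R.
have sq : sublinear q.
  split=> [x y|t x t0]; rewrite /q; last by rewrite sp.2// mulrCA.
  by rewrite -mulrDr ler_wpM2l// sp.1.
have qE x : (q x)%:E = 2^-1%:E * \int[area i K]_v `|dot x (vec v)|%:E.
  by rewrite /q EFinM pE mul1mx.
have ex : exists P, convex_body P /\ forall u : 'cV[R]_n.+1,
    (support_fun P u)%:E = 2^-1%:E * \int[area i K]_v `|dot u (vec v)|%:E.
  exists (support_body q); split=> [|u]; first exact: support_bodyP.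
  by rewrite support_fun_body.
have [_ hP] := xgetPex set0 ex.
exists q; split=> // x; split=> //.
by apply: EFin_inj; rewrite qE; exact/esym/hP.
Qed.

End Bodies.

(** * Zonal measures: symmetry in u and v, and existence of the body Phi *)

Section Zonal.
Variables (R : realType) (n : nat) (e : sphere R n).
Local Open Scope ereal_scope.
Variables (mu : {finite_measure set (borel (sphere R n)) -> \bar R}).
Hypotheses (n2 : (2 <= n)%N) (zmu : zonal e mu).

(** If k fixes the pole and carries x to y, then x . w = y . k w, and [mu] is unchanged by its
    pushforward under k. *)
Lemma zonal_cosine x y : dot x x = dot y y -> dot x (vec e) = dot y (vec e) ->
  \int[mu]_w `|dot x (vec w)|%:E = \int[mu]_w `|dot y (vec w)|%:E.
Proof.
move=> xx xe; have [k kx] := stab_transitive n2 xx xe.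
have mk : measurable_fun setT
    (act (Defs.rot k) : borel (sphere R n) -> borel (sphere R n)).
  by apply: continuous_measurable_borel; exact: act_continuous.
transitivity (\int[pushforward mu (act (Defs.rot k) :
    borel (sphere R n) -> borel (sphere R n))]_w `|dot y (vec w)|%:E).
  rewrite ge0_integral_pushforward//.
  - rewrite preimage_setT; apply: eq_integral => w _ /=.
    by rewrite dot_act -kx mulmxA (SO_trmx (matP _)) mul1mx.
  - by apply/measurable_EFinP; exact: measurable_abs_dot.
by apply: eq_measure_integral => A mA _; exact: zmu.
Qed.

Variable theta : sphere R n -> SO R n.
Hypothesis htheta : forall v, act (theta v) e = v.

Lemma theta_vec v : mat (theta v) *m vec e = vec v.
Proof. by rewrite -[in RHS](htheta v). Qed.

(** On the right v enters only through the dot product and no longer through [theta v], which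
    prepares both measurability in v and Tonelli. *)
Lemma support_fun_Zbody_swap u v :
  (support_fun (Zbody theta mu v) (vec u))%:E =
  \int[mu]_w `|dot (vec v) (vec (act (theta u) w))|%:E.
Proof.
rewrite support_fun_Zbody; under [RHS]eq_integral do rewrite dot_act.
have dotT w x y : dot ((mat (theta w))^T *m x) ((mat (theta w))^T *m y) = dot x y.
  by rewrite dot_mulmxl trmxK mulmxA (matP (theta w)).1 mul1mx.
have dote w x : dot ((mat (theta w))^T *m x) (vec e) = dot x (vec w).
  by rewrite dot_mulmxl trmxK theta_vec.
apply: zonal_cosine; last by rewrite !dote dotC.
by rewrite !dotT (vecP u) (vecP v).
Qed.

(* As theta need not be measurable, v is first moved out of theta v. *)
Lemma measurable_support_fun_Zbody x :
  measurable_fun setT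
    ((fun v => support_fun (Zbody theta mu v) x) : borel (sphere R n) -> R).
Proof.
(* The swap concerns unit directions; positive homogeneity reduces a nonzero x to its
   normalisation. *)
have sZ t v : (0 <= t)%R -> support_fun (Zbody theta mu v) (t *: x)
    = (t * support_fun (Zbody theta mu v) x)%R.
  move=> t0; have [p [sp pE]] := cosine_sublinear mu (mat (theta v))^T.
  by apply: EFin_inj; rewrite EFinM !support_fun_Zbody -!pE sp.2.
have [->|x0] := eqVneq x 0%R.
  rewrite (_ : (fun v => _) = cst 0%R)//; apply/funext => v.
  have [p [sp pE]] := cosine_sublinear mu (mat (theta v))^T.
  by apply: EFin_inj; rewrite support_fun_Zbody -pE sublinear0.
have xx0 : (0 < dot x x)%R.
  by rewrite lt_neqAle eq_sym dot_eq0 x0 sumr_ge0// => j _; rewrite -expr2 sqr_ge0.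
pose r := Num.sqrt (dot x x); have r0 : (0 < r)%R by rewrite sqrtr_gt0.
have hu : sphere_set (r^-1 *: x).
  by rewrite /sphere_set/= dotZl dotZr mulrA -expr2 exprVn sqr_sqrtr ?ltW// mulVf ?gt_eqF.
pose u := mk_sphere hu.
rewrite (_ : (fun v => _) = fun v => (r * support_fun (Zbody theta mu v) (vec u))%R);
    last first.
  apply/funext => v; rewrite sZ ?invr_ge0 ?ltW//.
  by rewrite mulrA divff ?gt_eqF// mul1r.
apply: measurable_funM => //; apply/measurable_EFinP.
(* After the swap this is a partial integral over [mu] of a jointly measurable function. *)
rewrite (_ : EFin \o _ =
    fubini_F mu (fun vw : (borel (sphere R n) * borel (sphere R n))%type =>
      `|dot (vec vw.1) (vec (act (theta u) vw.2))|%:E)).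
  apply: measurable_fun_fubini_tonelli_F => //.
  by apply/measurable_EFinP; exact: measurable_abs_dot_act.
by apply/funext => v; rewrite /= support_fun_Zbody_swap.
Qed.

(** Existence again suffices. The integrand is sublinear in the direction, measurable in v, and
    bounded uniformly in v by the l^1 norm of the direction times the mass of [mu]. *)
Lemma support_fun_Phi i (K : set 'cV[R]_n.+1) x :
  (support_fun (Phi theta mu i K) x)%:E =
  \int[area i K]_v (support_fun (Zbody theta mu v) x)%:E.
Proof.
have hZ v y : (0 <= support_fun (Zbody theta mu v) y)%R.
  by rewrite -lee_fin support_fun_Zbody integral_ge0// => w _; rewrite lee_fin.
have [] := @sublinear_integral R n.+1 _ _ (area i K)
  (fun v => support_fun (Zbody theta mu v))
  (fun y => ((\sum_j `|y j 0|) * fine (mu setT))%R).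
- move=> v; have [p [sp pE]] := cosine_sublinear mu (mat (theta v))^T.
  rewrite (_ : support_fun _ = p)//; apply/funext => y.
  by apply: EFin_inj; rewrite support_fun_Zbody pE.
- move=> v y; rewrite hZ/= -lee_fin EFinM fineK ?fin_num_measure// support_fun_Zbody.
  rewrite -(integral_cst _ measurableT); apply: ge0_le_integral => //.
  + by apply/measurable_EFinP; exact: measurable_abs_dot.
  + by move=> w _; rewrite lee_fin -dot_act abs_dot_le.
- exact: measurable_support_fun_Zbody.
move=> p [sp pE].
have ex : exists P, convex_body P /\ forall u : 'cV[R]_n.+1,
    (support_fun P u)%:E = \int[area i K]_v (support_fun (Zbody theta mu v) u)%:E.
  exists (support_body p); split=> [|u]; first exact: support_bodyP.
  by rewrite support_fun_body.
by have [_ ->] := xgetPex set0 ex.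
Qed.

End Zonal.

Theorem lemma3p2 (R : realType) (n : nat) (hn : (3 <= n.+1)%N)
    (e : sphere R n)
    (theta : sphere R n -> SO R n) (htheta : forall v, act (theta v) e = v)
    (dk : probability (borel (stab e)) R) (hdk : is_haar dk)
    (mu : {finite_measure set (borel (sphere R n)) -> \bar R})
    (hmu0 : nontrivial_measure mu) (hmueven : even_measure mu)
    (hmuzonal : zonal e mu)
    (mubreve : {finite_measure set (borel (SO R n)) -> \bar R})
    (hmubreve : is_pullback theta dk mu mubreve)
    (i : nat) (hi : (1 <= i <= n.+1 - 1)%N)
    (K : set 'cV[R]_n.+1) (hK : convex_body K) (u : sphere R n) :
  ((support_fun (Phi theta mu i K) (vec u))%:E =
   2%:E * \int[conj_measure (theta u) mubreve]_phi
            (support_fun (projection_body i K) (vec (act phi u)))%:E)%E.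
Proof.
have n2 : (2 <= n)%N by [].
have [p [sp pE]] := projection_body_sublinear i K.
pose f phi : R := p (vec (act phi u)).
(* The pullback identity is given for continuous integrands, so [f] and the conjugation must both be
   continuous. *)
have cf : continuous f.
  move=> phi; apply: (@continuous_comp _ _ _ (fun phi => vec (act phi u)) p).
    apply: (@continuous_comp _ _ _ (fun phi => act phi u) (@vec R n)).
      exact: act_continuousl.
    exact: vec_continuous.
  exact: sublinear_continuous.
have p0 x : 0 <= p x.
  rewrite -lee_fin (pE x).2; apply: mule_ge0; first by rewrite lee_fin.
  by apply: integral_ge0 => v _; rewrite lee_fin.
have cc : continuous (conjSO (theta u)) by exact: conjSO_continuous.
have -> : (\int[conj_measure (theta u) mubreve]_phi
    (support_fun (projection_body i K) (vec (act phi u)))%:E =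
    \int[mubreve]_phi (f (conjSO (theta u) phi))%:E)%E.
  rewrite ge0_integral_pushforward//.
  - rewrite preimage_setT; apply: eq_integral => phi _ /=.
    by rewrite -(pE _).1.
  - exact: continuous_measurable_borel.
  - under eq_fun do rewrite -(pE _).1.
    by apply/measurable_EFinP; exact: continuous_measurable_realfun.
  - by move=> phi _; rewrite lee_fin -(pE _).1.
have [_ ->] := hmubreve; last first.
  by move=> phi; apply: continuous_comp; [exact: cc|exact: cf].
(* The inverse of [theta u] sends u to the pole, k fixes it and [theta w] sends it to w: the value
   is independent of k. *)
have fE w (k : stab e) : f (conjSO (theta u) (mulSO (theta w) (Defs.rot k))) =
    p (vec (act (theta u) w)).
  have ue : act (invSO (theta u)) u = e.
    apply: vec_inj; change ((mat (theta u))^T *m vec u = vec e).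
    by rewrite -(theta_vec htheta u) mulmxA (SO_trmx (matP _)) mul1mx.
  have ke : act (Defs.rot k) e = e by exact: stabP.
  by rewrite /f /conjSO !act_mulSO ue ke htheta.
(* The integrand is constant in k and [dk] has mass 1. *)
have inner w : (\int[dk]_k (f (conjSO (theta u) (mulSO (theta w) (Defs.rot k))))%:E =
    2^-1%:E * \int[area i K]_v `|dot (vec v) (vec (act (theta u) w))|%:E)%E.
  transitivity (\int[dk]_k (cst (p (vec (act (theta u) w)))%:E k))%E.
    by apply: eq_integral => k _; rewrite fE.
  rewrite integral_cst// [X in (_ * X)%E](probability_setT dk) mule1 (pE _).2.
  by congr (_ * _)%E; apply: eq_integral => v _; rewrite dotC.
under eq_integral => w _ do rewrite inner.
pose F (vw : (borel (sphere R n) * borel (sphere R n))%type) : \bar R :=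
  `|dot (vec vw.1) (vec (act (theta u) vw.2))|%:E.
have F0 vw : (0 <= F vw)%E by rewrite lee_fin.
have mF : measurable_fun setT F.
  by apply/measurable_EFinP; exact: measurable_abs_dot_act.
rewrite ge0_integralZl_EFin//; last 2 first.
- by move=> w _; apply: integral_ge0 => v _; rewrite lee_fin.
- exact: (measurable_fun_fubini_tonelli_G (m1 := area i K) F).
(* The factor 2 cancels the 1/2 of the projection body; Tonelli then makes [mu] the inner measure,
   as in the swapped form of [Zbody]. *)
rewrite muleA -EFinM divff// mul1e -(fubini_tonelli F mF F0).
rewrite (support_fun_Phi n2 hmuzonal htheta); apply: eq_integral => v _.
by rewrite (support_fun_Zbody_swap n2 hmuzonal htheta).
Qed.
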